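(* Let $\alpha\in(0,1)$ be fixed. There exists a constant $M=M(\alpha)$ such that the following holds. If the prior densities $\gamma,\pi:[0,\infty)\to(0,\infty)$ are positive and uniformly continuous, and $\Pi(\cdot\mid Y,Z)$ is the marginal posterior of $\sigma^2$ under the Gaussian mixture prior described in the context, then for any compact sets $K\subset(0,\infty)$ and $K'\subset(-\infty,\infty)$, as $n\to\infty$, $$\sup_{\sigma_0^2\in K,\ \mu_i^0\in K'\,\forall i}\ E_0^n\Big[\Pi\Big(\Big|\frac{\sigma^2}{\sigma_0^2}-1\Big|\geq M\sqrt{\frac{\log n}{n}}\ \Big|\ Y,Z\Big)\Big]\to 0.$$
   Context: Model: for fixed $\alpha$ and sample size $n$, put $n_1=\lfloor n\alpha\rfloor$ and $n_2=n-n_1$. One observes independent $X_i\sim\mathcal{N}(\mu_i^0\mathbf{1}(i>n\alpha),\sigma_0^2)$, $i=1,\ldots,n$, with $\sigma_0^2>0$ and $\mu_0=(\mu^0_{n_1+1},\ldots,\mu^0_n)\in\mathbb{R}^{n_2}$ unknown. Write $Y=(X_1,\ldots,X_{n_1})$ and $Z=(X_{n_1+1},\ldots,X_n)$. $E_0^n$ denotes expectation under this model with true parameters $(\sigma_0^2,\mu_0)$; ''$\mu_i^0\in K'$ $\forall i$'' refers to all $i=n_1+1,\ldots,n$. $\|\cdot\|$ is the Euclidean norm. Gaussian mixture prior: $\gamma$ and $\pi$ are Lebesgue probability densities on $[0,\infty)$ not depending on $n$. The variance $\sigma^2$ has prior density $\pi$ and is independent of the mean vector $\mu\in\mathbb{R}^{n_2}$;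 $\mu$ is generated by first drawing $\theta^2\sim\gamma$ and then, given $\theta^2$, drawing the components $\mu_i\mid\theta^2\sim\mathcal{N}(0,\theta^2)$ independently, $i>n_1$. Let $\nu$ be the resulting prior distribution of $\mu$ on $\mathbb{R}^{n_2}$. Marginal posterior: $\Pi(\cdot\mid Y,Z)$ has density $$\pi(\sigma^2\mid Y,Z)\propto \sigma^{-n}e^{-\frac{\|Y\|^2}{2\sigma^2}}\Big(\int_{\mathbb{R}^{n_2}}e^{-\frac{\|Z-\mu\|^2}{2\sigma^2}}\,d\nu(\mu)\Big)\pi(\sigma^2),\quad \sigma^2>0.$$ *)

(* Defs.v *)
From HB Require Import structures.
From mathcomp Require Import all_boot all_order all_algebra.
From mathcomp Require Import all_classical all_reals all_analysis.
From mathcomp Require Import measurable_realfun giry.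

Set Implicit Arguments.
Unset Strict Implicit.
Unset Printing Implicit Defensive.

Import Order.TTheory GRing.Theory Num.Theory.
Import numFieldNormedType.Exports.

Local Open Scope classical_set_scope.
Local Open Scope ring_scope.
Local Open Scope ereal_scope.

Section product_probability.
Context d (T : measurableType d) (R : realType).

Definition tuple_consp n (u : T * n.-tuple T) : n.+1.-tuple T :=
  [tuple of u.1 :: u.2].

Let measurable_tuple_consp n : measurable_fun setT (@tuple_consp n).
Proof. exact: measurable_cons measurable_fst measurable_snd. Qed.

HB.instance Definition _ n := isMeasurableFun.Build _ _ _ _
  (@tuple_consp n) (@measurable_tuple_consp n).

(* The product measure P 0 \x ... \x P (n - 1), i.e. the joint law of n
   independent variables with laws P i; see prod_prob_box. *)
Fixpoint prod_prob n : ('I_n -> probability T R) -> probability (n.-tuple T) R :=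
  match n with
  | 0 => fun=> \d_[tuple]
  | m.+1 => fun P => distribution
      (P ord0 \x prod_prob (fun i => P (lift ord0 i))) (@tuple_consp m)
  end.

Lemma prod_prob_box n (P : 'I_n -> probability T R) (A : 'I_n -> set T) :
  (forall i, measurable (A i)) ->
  prod_prob P [set x | forall i, A i (tnth x i)] = \prod_(i < n) P i (A i).
Proof.
elim: n P A => [|n IH] P A mA.
  by rewrite big_ord0 /= diracE mem_set//= => -[].
rewrite big_ord_recl -IH//= /distribution /pushforward.
rewrite -product_measure1E//; last first.
  rewrite [X in measurable X](_ : _ =
      \bigcap_(i in [set: 'I_n]) (@tnth _ T ^~ i) @^-1` (A (lift ord0 i))).
    apply: fin_bigcap_measurable => // i _.
    by rewrite -[X in measurable X]setTI; exact: measurable_tnth.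
  by apply/seteqP; split => x/= => [+ i _|+ i]; apply.
congr (_ _); apply/seteqP; split => -[x y]/=.
  by move=> h; split => [|i]; [exact: (h ord0)|have := h (lift ord0 i); rewrite tnthS].
by move=> [h0 h] i; case: (unliftP ord0 i) => [j ->|->//]; rewrite tnthS.
Qed.

Lemma measurable_prod_prob d' (S : measurableType d') n
    (P : 'I_n -> S -> probability T R) :
  (forall i A, measurable A -> measurable_fun [set: S] (fun s => P i s A)) ->
  forall A, measurable A ->
    measurable_fun [set: S] (fun s => prod_prob (P ^~ s) A).
Proof.
elim: n P => [|n IH] P mP A mA /=; first exact: measurable_cst.
have m0 : measurable_fun [set: S] (fun s => P ord0 s : giry T R).
  by apply: measurable_giry_codensity => // B mB; exact: mP.
have m1 : measurable_fun [set: S]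
    (fun s => prod_prob (fun i => P (lift ord0 i) s) : giry _ R).
  by apply: measurable_giry_codensity => // B mB; apply: IH => // i; exact: mP.
have mC : measurable (@tuple_consp n @^-1` A).
  rewrite -[X in measurable X]setTI; exact: measurable_tuple_consp.
have mq := measurableT_comp measurable_giry_prod (measurable_fun_pair m0 m1).
exact: (measurableT_comp (measurable_giry_ev mC) mq).
Qed.

End product_probability.

Section normal_prob_measurable.
Context {R : realType}.

Let measurable_invf d (T : measurableType d) (f : T -> R) :
  (forall x, (0 <= f x)%R) -> measurable_fun [set: T] f ->
  measurable_fun [set: T] (fun x => (f x)^-1)%R.
Proof.
move=> f0 mf.
have -> : (fun x => (f x)^-1)%R = (fun y : R => y `^ (-1))%R \o f.
  by apply/funext => x /=; rewrite powR_inv1.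
by apply: measurableT_comp => //; exact: measurable_powR.
Qed.

Lemma measurable_normal_prob (m : R) (A : set R) : measurable A ->
  measurable_fun [set: R] (fun s => normal_prob m s A).
Proof.
move=> mA.
pose f (z : R * R) : \bar R := (normal_pdf m z.1 z.2 * \1_A z.2)%:E.
have mf : measurable_fun [set: R * R] f.
  apply/measurable_EFinP; apply: measurable_funM; last first.
    by apply: measurableT_comp => //; exact: measurable_indic.
  rewrite /normal_pdf; apply: measurable_fun_ifT => /=.
  - exact: measurable_fun_eqr.
  - by apply: measurableT_comp => //; exact: measurable_indic.
  - have ms2 : measurable_fun [set: R * R] (fun z => z.1 ^+ 2)%R.
      exact: measurable_funX.
    apply: measurable_funM; rewrite /normal_peak /normal_fun.
      apply: measurable_invf => [z|]; first exact: sqrtr_ge0.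
      apply: (measurableT_comp
        (continuous_measurable_fun (@sqrt_continuous R))) => /=.
      under eq_fun do rewrite -mulr_natr.
      by do 2 apply: measurable_funM => //.
    apply: measurableT_comp => //; apply: measurable_funM.
      by apply: measurableT_comp => //; apply/measurable_funX/measurable_funB.
    apply: measurable_invf => [z|]; first by rewrite mulrn_wge0 ?sqr_ge0.
    by under eq_fun do rewrite -mulr_natr; exact: measurable_funM.
have f0 z : 0 <= f z.
  by rewrite lee_fin mulr_ge0// normal_pdf_ge0.
have := @measurable_fun_fubini_tonelli_F _ _ _ _ R lebesgue_measure f mf f0.
apply: eq_measurable_fun => s _; rewrite /fubini_F /normal_prob.
rewrite [RHS]integral_mkcond; apply: eq_integral => x _.
by rewrite patchE /f indicE; case: ifPn => _; rewrite ?mulr1 ?mulr0.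
Qed.

End normal_prob_measurable.

(* Lebesgue probability densities on [0, +oo[; values on ]-oo, 0[ are junk. *)
Record density (R : realType) := Density {
  dens :> R -> R ;
  measurable_dens : measurable_fun (`[0%R, +oo[ : set R) dens ;
  dens_ge0 : forall x, (0 <= x)%R -> (0 <= dens x)%R ;
  integral_dens : \int[lebesgue_measure]_(x in `[0%R, +oo[) (dens x)%:E = 1 }.

Section gaussian_mixture.
Context {R : realType}.

Local Notation RT := (measurableTypeR R).

(* N(m, v * Id), v being the variance (normal_prob takes the standard
   deviation). For v <= 0 this is a junk value, which only matters on the null
   set {0} in the integral defining mixture. *)
Definition gauss n (m : 'I_n -> R) (v : R) : probability (n.-tuple RT) R :=
  prod_prob (fun i => normal_prob (m i) (Num.sqrt v)).

Section mixture.
Variables (gamma : density R) (n : nat).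

(* The law on R^n of mu, when theta^2 = t has density gamma and, given t, the
   coordinates of mu are i.i.d. N(0, t). *)
Definition mixture (A : set (n.-tuple RT)) : \bar R :=
  \int[lebesgue_measure]_(t in `[0%R, +oo[)
    ((gamma t)%:E * gauss (fun _ : 'I_n => 0%R) t A).

Let mgauss A : measurable A ->
  measurable_fun (`[0%R, +oo[ : set R) (fun t : R =>
    (gamma t)%:E * gauss (fun _ : 'I_n => 0%R) t A).
Proof.
move=> mA; apply: emeasurable_funM.
  by apply/measurable_EFinP; exact: measurable_dens.
apply: (@measurable_funS _ _ _ _ setT) => //.
apply: measurable_prod_prob => // i B mB.
apply: (measurableT_comp (measurable_normal_prob _ mB)).
exact: continuous_measurable_fun (@sqrt_continuous R).
Qed.

Let gauss_ge0 A t : t \in `[0%R, +oo[ ->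
  0 <= (gamma t)%:E * gauss (fun _ : 'I_n => 0%R) t A.
Proof.
by rewrite in_itv/= andbT => t0; rewrite mule_ge0// lee_fin; exact: dens_ge0.
Qed.

Let mixture0 : mixture set0 = 0.
Proof. by rewrite /mixture; apply: integral0_eq => t _; rewrite measure0 mule0. Qed.

Let mixture_ge0 A : 0 <= mixture A.
Proof. by apply: integral_ge0 => t t0; exact: gauss_ge0. Qed.

Let mixture_sigma_additive : semi_sigma_additive mixture.
Proof.
move=> F mF tF mUF.
have -> : mixture (\bigcup_n F n) = \sum_(0 <= k <oo) mixture (F k).
  rewrite /mixture -integral_nneseries//; last 2 first.
  - by move=> k; exact: mgauss.
  - by move=> k t t0; exact: gauss_ge0.
  apply: eq_integral => t; rewrite inE/= => t0.
  rewrite measure_semi_bigcup// nneseriesZl//.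
by apply: is_cvg_ereal_nneg_natsum => k _; exact: mixture_ge0.
Qed.

HB.instance Definition _ := isMeasure.Build _ _ _ mixture
  mixture0 mixture_ge0 mixture_sigma_additive.

Let mixture_setT : mixture setT = 1.
Proof.
rewrite /mixture -(integral_dens gamma); apply: eq_integral => t _.
by rewrite probability_setT mule1.
Qed.

HB.instance Definition _ := Measure_isProbability.Build _ _ _ mixture
  mixture_setT.

End mixture.
Arguments mixture gamma n A : clear implicits.

Definition sqnorm n (x : 'I_n -> R) : R := (\sum_(i < n) x i ^+ 2)%R.

Section model.
Variables (alpha : R) (n : nat).

(* n_1, the floor of n * alpha, for alpha >= 0 *)
Definition nnull : nat := Num.truncn (n%:R * alpha)%R.

(* Coordinates are numbered from 0: the (i + 1)-th observation is tnth x i. *)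
Definition Ypart (x : n.-tuple RT) := [tuple of take nnull x].
Definition Zpart (x : n.-tuple RT) : (n - nnull).-tuple RT :=
  [tuple of drop nnull x].

Definition mean (mu0 : (n - nnull).-tuple R) (i : 'I_n) : R :=
  (if n%:R * alpha < i.+1%:R then nth 0 mu0 (i - nnull)%N else 0)%R.

Variables gamma varpi : density R.

(* The unnormalized posterior density of the variance v; posterior normalizes
   it over ]0, +oo[ (the normalizing constant is positive, and it is finite as
   soon as Ypart x is not the zero vector). *)
Definition post_weight (x : n.-tuple RT) (v : R) : \bar R :=
  (Num.sqrt v ^- n * expR (- sqnorm (tnth (Ypart x)) / (2 * v)))%R%:E *
  (\int[mixture gamma (n - nnull)%N]_mu
     (expR (- sqnorm (tnth (Zpart x) \- tnth mu) / (2 * v)))%R%:E) *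
  (varpi v)%:E.

Definition posterior (x : n.-tuple RT) (B : set R) : \bar R :=
  (\int[lebesgue_measure]_(v in B `&` `]0%R, +oo[) post_weight x v) /
  (\int[lebesgue_measure]_(v in `]0%R, +oo[) post_weight x v).

End model.
End gaussian_mixture.
Arguments mean {R} alpha {n} mu0 i.
Arguments posterior {R} alpha {n} gamma varpi x B.

(* Main.v *)
(* Given theta^2 = t, integrating mu out turns the likelihood of Z into that of
   i.i.d. N(0, sigma^2 + t) observations, so the posterior density of sigma^2 = v
   is proportional to F(v) G(v) varpi(v), where F is the likelihood of Y and
   G(v) is the integral of gamma(t) H(v + t), H(u) = u^(-q/2) exp(-|Z|^2 / (2u)),
   q = n - n_1.  Put eps = sqrt(log n / n).  The maximizer D = |Z|^2 / q of H is,
   with high probability, bounded and at least sigma_0^2 (1 - eps), because the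
   unknown means can only inflate |Z|^2.  Hence G <= max H everywhere, whereas
   for v between sigma_0^2 (1 - 2 eps) and sigma_0^2 (1 - eps) the values t with
   v + t in [D, D (1 + eps)] give G(v) >= c eps n^(-1/2) max H.  So G varies by
   polynomial factors in n only, and their degree does not depend on the prior.
   The maximizer of F is sigma_0^2 (1 + O(eps)) with high probability, and
   outside a window of relative width M eps the likelihood F drops below its
   maximum by a factor n^(-c alpha M^2), which wins for M large. *)
Require Import Defs.
From mathcomp Require Import all_boot all_order all_algebra.
From mathcomp Require Import all_classical all_reals all_analysis.
From mathcomp Require Import measurable_realfun giry ring lra.
Import Order.TTheory GRing.Theory Num.Theory.
Import numFieldNormedType.Exports.
Local Open Scope classical_set_scope.
Local Open Scope ring_scope.

Set Implicit Arguments.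
Unset Strict Implicit.
Unset Printing Implicit Defensive.

(** * Integrals of nonnegative functions *)

Section integrals.
Local Open Scope ereal_scope.

(* Unlike [ge0_subset_integral] and [ge0_le_integral], no measurability is
   assumed, so that this applies to the posterior, whose measurability in the
   data would otherwise have to be established. *)
Lemma ge0_subset_le_integral d (T : measurableType d) (R : realType)
    (mu : {measure set T -> \bar R}) (A B : set T) (f g : T -> \bar R) :
  A `<=` B -> (forall x, A x -> 0 <= f x) -> (forall x, B x -> 0 <= g x) ->
  (forall x, A x -> f x <= g x) ->
  \int[mu]_(x in A) f x <= \int[mu]_(x in B) g x.
Proof.
move=> AB f0 g0 fg; rewrite !ge0_integralE//; apply: ereal_sup_le => _ [h hf <-].
exists h => //= x; apply: (le_trans (hf x)); rewrite !patchE.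
case: ifPn => [/set_mem Ax|_]; first by rewrite mem_set ?fg//; exact: AB.
by case: ifPn => // /set_mem /g0.
Qed.

Import HBNNSimple.

(** For indicators this is the assumption on [m]; simple functions and monotone convergence do the
    rest. It serves the mixture prior and, with Dirac kernels, measures given by a density. *)
Lemma ge0_integral_bind d d' (S : measurableType d) (T : measurableType d')
    (R : realType) (mu : {measure set S -> \bar R}) (D : set S) (g : S -> R)
    (k : S -> probability T R) (m : {measure set T -> \bar R}) :
  measurable D -> measurable_fun D g -> (forall s, D s -> (0 <= g s)%R) ->
  (forall A, measurable A -> measurable_fun [set: S] (fun s => k s A)) ->
  (forall A, measurable A -> m A = \int[mu]_(s in D) ((g s)%:E * k s A)) ->
  forall f : T -> \bar R, measurable_fun [set: T] f -> (forall x, 0 <= f x) ->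
  \int[m]_x f x = \int[mu]_(s in D) ((g s)%:E * \int[k s]_x f x).
Proof.
move=> mD mg g0 mk mE f mf f0.
have mgk h : measurable_fun [set: T] h -> (forall x, 0 <= h x) ->
    measurable_fun D (fun s => (g s)%:E * \int[k s]_x h x).
  move=> mh h0; apply: emeasurable_funM; first exact/measurable_EFinP.
  apply: (@measurable_funS _ _ _ _ setT) => //.
  have mk' : measurable_fun [set: S] (fun s => k s : giry T R).
    exact: measurable_giry_codensity.
  exact: (measurableT_comp (measurable_giry_int mh h0) mk').
pose h := nnsfun_approx measurableT mf.
have hE (nu : {measure set T -> \bar R}) n :
    \int[nu]_x (h n x)%:E = \sum_(r \in range (h n)) r%:E * nu (h n @^-1` [set r]).
  by rewrite integralT_nnsfun sintegralE.
have mh n : measurable_fun [set: T] (EFin \o h n) by exact/measurable_EFinP.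
have h0 n x : 0 <= (EFin \o h n) x by rewrite lee_fin.
have ndh x : {homo (fun n => (EFin \o h n) x) : n p / (n <= p)%O >-> n <= p}.
  by move=> *; exact/lefP/nd_nnsfun_approx.
have fE (nu : {measure set T -> \bar R}) :
    \int[nu]_x f x = limn (fun n => \int[nu]_x (h n x)%:E).
  rewrite -(monotone_convergence nu measurableT mh (fun n x _ => h0 n x)
    (fun x _ => ndh x)); apply: eq_integral => t _.
  by apply/esym/cvg_lim => //; exact: cvg_nnsfun_approx.
rewrite fE; transitivity
    (limn (fun n => \int[mu]_(s in D) ((g s)%:E * \int[k s]_x (h n x)%:E))).
  apply: congr_lim; apply/funext => n; rewrite hE.
  under [RHS]eq_integral => s Ds.
    rewrite hE ge0_mule_fsumr; last by move=> r; exact: nnsfun_mulemu_ge0.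
    over.
  rewrite ge0_integral_fsum//; last 2 first.
  - move=> r; apply: emeasurable_funM; first exact/measurable_EFinP.
    apply: measurable_funeM; apply: (@measurable_funS _ _ _ _ setT) => //.
    exact: mk.
  - move=> r s Ds; rewrite mule_ge0//; first by rewrite lee_fin g0.
    exact: nnsfun_mulemu_ge0.
  apply: eq_fsbigr => r; rewrite inE => -[x _ <-]; rewrite mE//.
  rewrite -ge0_integralZl//; last 3 first.
  - apply: emeasurable_funM; first exact/measurable_EFinP.
    by apply: (@measurable_funS _ _ _ _ setT) => //; exact: mk.
  - by move=> s Ds; rewrite mule_ge0// lee_fin g0.
  - by rewrite lee_fin.
  by apply: eq_integral => s _; rewrite muleCA.
have le_h s n p : (n <= p)%N -> \int[k s]_x (h n x)%:E <= \int[k s]_x (h p x)%:E.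
  move=> np; apply: ge0_le_integral => //.
  - by move=> x _; exact: h0.
  - exact: mh.
  - exact: mh.
  - by move=> x _; exact: ndh.
rewrite -monotone_convergence//.
- apply: eq_integral => s Ds; rewrite fE limeMl//.
  by apply/ereal_nondecreasing_is_cvgn => a b ab; exact: le_h.
- by move=> n; apply: mgk (mh n) (h0 n).
- move=> n s Ds; rewrite mule_ge0//; first by rewrite lee_fin g0.
  by apply: integral_ge0 => x _; exact: h0.
- move=> s Ds n p np; rewrite lee_wpmul2l//; first by rewrite lee_fin g0.
  exact: le_h.
Qed.

Lemma ge0_integral_density d (T : measurableType d) (R : realType)
    (mu m : {measure set T -> \bar R}) (g : T -> R) :
  measurable_fun [set: T] g -> (forall x, (0 <= g x)%R) ->
  (forall A, measurable A -> m A = \int[mu]_(x in A) (g x)%:E) ->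
  forall f : T -> \bar R, measurable_fun [set: T] f -> (forall x, 0 <= f x) ->
  \int[m]_x f x = \int[mu]_x ((g x)%:E * f x).
Proof.
move=> mg g0 mE f mf f0.
rewrite (@ge0_integral_bind _ _ _ _ _ mu setT g (fun x => \d_x))//.
- by apply: eq_integral => x _; rewrite integral_dirac// diracT mul1e.
- by move=> A mA; exact: measurable_fun_dirac.
- move=> A mA; rewrite mE// integral_mkcond; apply: eq_integral => x _.
  rewrite /= /dirac patchE indicE; case: ifPn => _; rewrite ?mule1 ?mule0//.
Qed.

Lemma ge0_integral_prod_prob d (T : measurableType d) (R : realType) n
    (P : 'I_n -> probability T R) (f : 'I_n -> T -> R) :
  (forall i, measurable_fun [set: T] (f i)) -> (forall i x, (0 <= f i x)%R) ->
  \int[prod_prob P]_x (\prod_(i < n) f i (tnth x i))%:E =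
  \prod_(i < n) \int[P i]_x (f i x)%:E.
Proof.
elim: n P f => [|n IH] P f mf f0 /=.
  rewrite big_ord0 integral_dirac//; last first.
    by under eq_fun do rewrite big_ord0; exact: measurable_cst.
  by rewrite diracT mul1e big_ord0.
have mprod m (h : 'I_m -> T -> R) : (forall i, measurable_fun [set: T] (h i)) ->
    measurable_fun [set: m.-tuple T] (fun x => (\prod_(i < m) h i (tnth x i))%:E).
  move=> mh; apply/measurable_EFinP; apply: measurable_prod => i _.
  by apply: measurableT_comp => //; exact: measurable_tnth.
rewrite ge0_integral_distribution//; last 2 first.
- exact: mprod.
- by move=> x; rewrite lee_fin prodr_ge0.
rewrite big_ord_recl -IH//.
set P' := prod_prob _.
rewrite (_ : _ \o _ = fun z : T * n.-tuple T =>
  (f ord0 z.1)%:E * (\prod_(i < n) f (lift ord0 i) (tnth z.2 i))%:E); last first.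
  apply/funext => -[x y] /=; rewrite big_ord_recl -EFinM; congr (_ * _)%:E.
  by apply: eq_bigr => i _; rewrite tnthS.
rewrite fubini_tonelli1//; last 2 first.
- apply: emeasurable_funM.
    by apply/measurable_EFinP; apply: measurableT_comp.
  exact: (measurableT_comp
    (mprod n (fun i => f (lift ord0 i)) (fun i => mf _)) measurable_snd).
- by move=> x; rewrite mule_ge0// lee_fin// prodr_ge0.
rewrite /fubini_F/=.
under eq_integral => x _.
  rewrite ge0_integralZl//; last 3 first.
  - exact: (mprod n (fun i => f (lift ord0 i)) (fun i => mf _)).
  - by move=> y _; rewrite lee_fin prodr_ge0.
  - by rewrite lee_fin.
  over.
rewrite ge0_integralZr//.
- exact/measurable_EFinP.
- by move=> x _; rewrite lee_fin.
- by apply: integral_ge0 => y _; rewrite lee_fin prodr_ge0.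
Qed.

End integrals.

(** * Gaussian integrals *)

Section gaussian_integrals.
Context {R : realType}.
Implicit Types (a z t v w : R).

Lemma sqrtr_expR_ln w : 0 < w -> Num.sqrt w = expR (ln w / 2).
Proof.
move=> w0; rewrite -[LHS]lnK ?posrE ?sqrtr_gt0//; congr expR.
by rewrite -[in RHS](sqr_sqrtr (ltW w0)) lnXn ?sqrtr_gt0// -[X in _ = X / _]mulr_natr mulfK.
Qed.

(* Completing the square: the product of the two Gaussian densities is a
   multiple of the density with variance t / w and mean (m + 2 a t z) / w,
   where w = 1 + 2 a t. *)
Lemma integral_normal_prob_expR m a z t : 0 < t -> 0 < 1 + 2 * a * t ->
  (\int[normal_prob m (Num.sqrt t)]_x (expR (- a * (z - x) ^+ 2))%:E =
   (expR (- ln (1 + 2 * a * t) / 2 - a * (z - m) ^+ 2 / (1 + 2 * a * t)))%:E)%E.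
Proof.
move=> t0; set w := 1 + _ => w0.
have st0 : Num.sqrt t != 0 by rewrite gt_eqF ?sqrtr_gt0.
have sw0 : Num.sqrt (t / w) != 0 by rewrite gt_eqF ?sqrtr_gt0 ?divr_gt0.
have mf : measurable_fun [set: R] (fun x => expR (- a * (z - x) ^+ 2)).
  apply: measurableT_comp => //; apply: measurable_funM => //.
  by apply: measurable_funX; exact: measurable_funB.
rewrite (@ge0_integral_density _ _ _ lebesgue_measure _
  (normal_pdf m (Num.sqrt t)))//; last 3 first.

- exact: measurable_normal_pdf.
- by move=> x; exact: normal_pdf_ge0.
- exact/measurable_EFinP.
set C := expR (_ - _).
have E x : normal_pdf m (Num.sqrt t) x * expR (- a * (z - x) ^+ 2) =
    C * normal_pdf ((m + 2 * a * t * z) / w) (Num.sqrt (t / w)) x.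
  rewrite !normal_pdfE// /normal_peak /normal_fun.
  rewrite !sqr_sqrtr ?divr_ge0 ?ltW// /C expRD [- ln w / 2]mulNr.
  rewrite [expR (- (ln w / 2))]expRN -sqrtr_expR_ln//.
  have -> : Num.sqrt (t * pi *+ 2) = Num.sqrt w * Num.sqrt (t / w * pi *+ 2).
    rewrite -sqrtrM ?ltW//; congr Num.sqrt.
    by field; rewrite gt_eqF.
  rewrite invfM -!mulrA; congr (_ * _).
  rewrite [RHS]mulrCA; congr (_ * _); rewrite -!expRD; congr expR.
  rewrite /w; field.
  by rewrite -/w !gt_eqF.
under eq_integral do rewrite -EFinM E EFinM.
rewrite ge0_integralZl//; last 3 first.
- by apply/measurable_EFinP; exact: measurable_normal_pdf.
- by move=> x _; rewrite lee_fin normal_pdf_ge0.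
- by rewrite lee_fin expR_ge0.
by rewrite integral_normal_pdf mule1.
Qed.

(** Independence factorizes the integral over the coordinates. The weights may vary, vanish or be
    negative: marginalizing the prior takes a constant weight, the Chernoff bounds take weights
    supported on a block of coordinates. *)
Lemma integral_gauss_expR n (m z a : 'I_n -> R) t :
  0 < t -> (forall i, 0 < 1 + 2 * a i * t) ->
  (\int[gauss m t]_x (expR (- \sum_(i < n) a i * (z i - tnth x i) ^+ 2))%:E =
   (expR (\sum_(i < n) (- ln (1 + 2 * a i * t) / 2 -
      a i * (z i - m i) ^+ 2 / (1 + 2 * a i * t))))%:E)%E.
Proof.
move=> t0 at0.
pose f i (x : R) := expR (- a i * (z i - x) ^+ 2).
transitivity (\int[gauss m t]_x (\prod_(i < n) f i (tnth x i))%:E)%E.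
  apply: eq_integral => x _; rewrite -sumrN expR_sum; congr EFin.
  by apply: eq_bigr => i _; rewrite /f mulNr.
rewrite /gauss (@ge0_integral_prod_prob _ (measurableTypeR R) R n _ f)//; last 2 first.
- move=> i; apply: measurableT_comp => //; apply: measurable_funM => //.
  by apply: measurable_funX; exact: measurable_funB.
- by move=> i x; exact: expR_ge0.
rewrite expR_sum -prodEFin; apply: eq_bigr => i _.
exact: integral_normal_prob_expR.
Qed.

End gaussian_integrals.

(** * Likelihood of a variance *)

Section profile.
Context {R : realType}.
Implicit Types (p s v x A : R).

(* The likelihood, up to a constant factor, of the variance [v] given [p]
   centered Gaussian observations with sum of squares [s]. *)
Definition profile p s v : R := expR (- (p * ln v + s / v) / 2).

(* Half the unit deviance: [profileE] reads the likelihood ratio with respect to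
   the maximum likelihood estimator [A] off [dev (v / A)]. *)
Definition dev x : R := ln x + x^-1 - 1.

Lemma profileE p A v : 0 < A -> 0 < v ->
  profile p (p * A) v = profile p (p * A) A * expR (- (p / 2) * dev (v / A)).
Proof.
move=> A0 v0; rewrite /profile /dev -expRD ln_div ?posrE//; congr expR.
by field; rewrite !gt_eqF.
Qed.

Lemma ln_le_sub1 x : 0 < x -> ln x <= x - 1.
Proof.
move=> x0; have := @le_ln1Dx R (x - 1); rewrite [1 + _]addrC subrK; apply; lra.
Qed.

Lemma dev_ge0 x : 0 < x -> 0 <= dev x.
Proof.
move=> x0; have := @ln_le_sub1 x^-1; rewrite invr_gt0 lnV ?posrE// => /(_ x0).
rewrite /dev; lra.
Qed.

(** As [(x - 1) ^ 2 / x = x - 2 + 1 / x], this is [ln x <= x - 1] again. It bounds likelihoods from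
    below near their maximum, whereas [dev_ge_sqr] bounds them from above away from it. *)
Lemma dev_le x : 0 < x -> dev x <= (x - 1) ^+ 2 / x.
Proof.
move=> x0; have := ln_le_sub1 x0; rewrite /dev.
have -> : (x - 1) ^+ 2 / x = x - 2 + x^-1 by field; rewrite gt_eqF.
lra.
Qed.

(* Applying [ln y <= y - 1] to [y = x ^ (-1/2)] gives
   [dev x >= (1 - x ^ (-1/2)) ^ 2]. *)
Lemma dev_ge_sqr d x : 0 <= d <= 1 -> 0 < x -> d <= `|x - 1| ->
  d ^+ 2 / 16 <= dev x.
Proof.
move=> /andP[d0 d1] x0 dx; set r := (Num.sqrt x)^-1.
have sx0 : 0 < Num.sqrt x by rewrite sqrtr_gt0.
have r0 : 0 < r by rewrite invr_gt0.
have r2 : r ^+ 2 = x^-1 by rewrite exprVn sqr_sqrtr ?ltW.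
have xr : x * r ^+ 2 = 1 by rewrite r2 divff// gt_eqF.
have le1 : (1 - r) ^+ 2 <= dev x.
  have := ln_le_sub1 r0; rewrite /dev.
  have -> : ln x = - (ln r *+ 2) by rewrite -lnXn// r2 lnV ?posrE// opprK.
  rewrite -r2 mulr2n; nra.
apply: le_trans le1.
(* Both cases show that [d] is at most [4 * |1 - r|], whence the constant 16. *)
have [x1|x1] := leP x 1.
  move: dx; rewrite ler0_norm; last lra.
  move=> dx; have r1 : 1 <= r.
    rewrite leNgt; apply/negP => r1; have : r ^+ 2 < 1 by nra.
    nra.
  have : d <= 2 * (r - 1).
    apply: (le_trans dx); rewrite -(ler_pM2r (exprn_gt0 2 r0)).
    have : 0 <= (r - 1) ^+ 2 * (2 * r + 1) by rewrite mulr_ge0 ?sqr_ge0//; lra.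
    have : (- (x - 1)) * r ^+ 2 = r ^+ 2 - x * r ^+ 2 by ring.
    rewrite xr => ->.
    have -> : 2 * (r - 1) * r ^+ 2 = (r - 1) ^+ 2 * (2 * r + 1) + r ^+ 2 - 1 by ring.
    lra.
  nra.
move: dx; rewrite gtr0_norm; last lra.
move=> dx; have r1 : r <= 1.
  rewrite leNgt; apply/negP => r1; have : 1 < r ^+ 2 by nra.
  nra.
(* If [r] exceeded [1 - d / 4], then [x * r ^ 2 >= (1 + d) * (1 - d / 4) ^ 2 > 1], against [xr]. *)
have : d <= 4 * (1 - r).
  rewrite leNgt; apply/negP => h.
  have h1 : 1 - d / 4 <= r by lra.
  have h2 : (1 - d / 4) ^+ 2 <= r ^+ 2 by nra.
  have h3 : (1 + d) * (1 - d / 4) ^+ 2 <= x * r ^+ 2.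
    by apply: ler_pM => //; [lra|exact: sqr_ge0|lra].
  have h4 : 0 < d by lra.
  have h5 : (1 + d) * (1 - d / 4) ^+ 2 = 1 + d * (1 / 2 - 7 / 16 * d + d ^+ 2 / 16) by field.
  have h6 : 0 < d * (1 / 2 - 7 / 16 * d + d ^+ 2 / 16).
    by rewrite mulr_gt0//; have := sqr_ge0 d; lra.
  lra.
nra.
Qed.

Lemma profile_ge0 p s v : 0 <= profile p s v. Proof. exact: expR_ge0. Qed.

Lemma profile_le p A v : 0 <= p -> 0 < A -> 0 < v ->
  profile p (p * A) v <= profile p (p * A) A.
Proof.
move=> p0 A0 v0; rewrite profileE// ler_piMr ?expR_ge0//.
rewrite -[leRHS]expR0 ler_expR mulNr oppr_le0 mulr_ge0 ?dev_ge0 ?divr_gt0//; lra.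
Qed.

Lemma measurable_profile p s : measurable_fun (`]0, +oo[ : set R) (profile p s).
Proof.
apply: measurableT_comp => //; apply: measurable_funM => //.
apply: measurableT_comp => //; apply: measurable_funD.
  by apply: measurable_funM => //; apply: measurable_funTS; exact: measurable_ln.
apply: measurable_funM => //.
apply: subspace_continuous_measurable_fun => //.
apply: continuous_in_subspaceT => x /set_mem /=; rewrite in_itv/= andbT => x0.
by apply: inv_continuous; rewrite gt_eqF.
Qed.

End profile.

(** * Posterior weights *)

Section posterior.
Context {R : realType}.
Local Notation RT := (measurableTypeR R).
Implicit Types (gamma varpi : density R) (t v : R).

Lemma ge0_integral_mixture gamma n (f : n.-tuple RT -> \bar R) :
  measurable_fun [set: n.-tuple RT] f -> (forall x, (0 <= f x)%E) ->
  (\int[@mixture R gamma n]_x f x = \int[lebesgue_measure]_(t in `[0%R, +oo[)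
    ((gamma t)%:E * \int[gauss (fun _ : 'I_n => 0%R) t]_x f x))%E.
Proof.
apply: (@ge0_integral_bind _ _ _ _ _ lebesgue_measure `[0%R, +oo[ gamma
  (fun t => gauss (fun _ : 'I_n => 0%R) t)) => //.
- exact: measurable_dens.
- by move=> t /=; rewrite in_itv/= andbT; exact: dens_ge0.
- move=> A mA; apply: measurable_prod_prob => // i B mB.
  apply: (measurableT_comp (measurable_normal_prob _ mB)).
  exact: continuous_measurable_fun (@sqrt_continuous R).
Qed.

Lemma measurable_profile_shift (p s v : R) : 0 < v ->
  measurable_fun (`]0, +oo[ : set R) (fun t => profile p s (v + t)).
Proof.
move=> v0; have sub : [set v + t | t in (`]0, +oo[ : set R)] `<=` `]0, +oo[.
  by move=> _ [t /= + <-]; rewrite !in_itv/= !andbT => t0; rewrite addr_gt0.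
have mI : measurable (`]0, +oo[ : set R) by [].
have mv : measurable_fun (`]0, +oo[ : set R) (fun t => v + t).
  exact: measurable_funD.
exact: (measurable_comp mI sub (measurable_profile p s) mv).
Qed.

Lemma measurable_dens_pos gamma : measurable_fun (`]0, +oo[ : set R) gamma.
Proof.
apply: measurable_funS (measurable_dens gamma) => //.
by move=> t /=; rewrite !in_itv/= !andbT => /ltW.
Qed.

(* The marginal likelihood of [Z]: given [theta ^ 2 = t], the coordinates of [Z]
   are i.i.d. with variance [v + t] once [mu] is integrated out. *)
Definition zweight gamma (q s v : R) : \bar R :=
  (\int[lebesgue_measure]_(t in `]0%R, +oo[)
    (gamma t * profile q s (v + t))%:E)%E.

Lemma integral_mixture_expR gamma n (z : n.-tuple RT) v : 0 < v ->
  (\int[@mixture R gamma n]_mu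
    (expR (- sqnorm (tnth z \- tnth mu) / (2 * v)))%:E =
   (expR (n%:R * ln v / 2))%:E * zweight gamma n%:R (sqnorm (tnth z)) v)%E.
Proof.
move=> v0.
have mf : measurable_fun [set: n.-tuple RT]
    (fun mu => (expR (- sqnorm (tnth z \- tnth mu) / (2 * v)))%:E).
  apply/measurable_EFinP; apply: measurableT_comp => //.
  apply: measurable_funM => //; apply: measurableT_comp => //.
  apply: measurable_sum => i; apply: measurable_funX.
  by apply: measurable_funB => //; exact: measurable_tnth.
have mg : measurable_fun (`]0, +oo[ : set R) (fun t =>
    (gamma t * profile n%:R (sqnorm (tnth z)) (v + t))%:E).
  apply/measurable_EFinP; apply: measurable_funM.
    exact: measurable_dens_pos.
  exact: measurable_profile_shift.
have E t : 0 < t -> (\int[gauss (fun _ : 'I_n => 0%R) t]_mu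
    (expR (- sqnorm (tnth z \- tnth mu) / (2 * v)))%:E =
    (expR (n%:R * ln v / 2) * profile n%:R (sqnorm (tnth z)) (v + t))%:E)%E.
  move=> t0.
  have w0 : 0 < 1 + 2 * (2 * v)^-1 * t.
    by rewrite addr_gt0// mulr_gt0// mulr_gt0// invr_gt0 mulr_gt0.
  have wE : 1 + 2 * (2 * v)^-1 * t = (v + t) / v by field; rewrite gt_eqF.
  under eq_integral => x _.
    rewrite (_ : - _ / _ =
      - \sum_(i < n) (2 * v)^-1 * (tnth z i - tnth x i) ^+ 2); last first.
      by rewrite -mulr_sumr mulNr [in LHS]mulrC.
    over.
  rewrite (@integral_gauss_expR _ _ _ _ (fun=> (2 * v)^-1))//.
  rewrite /profile -expRD; congr (expR _)%:E.
  rewrite wE ln_div ?posrE ?addr_gt0//.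
  rewrite big_split/= sumr_const card_ord -mulr_natl /sqnorm.
  under [X in _ + X = _]eq_bigr do rewrite subr0.
  rewrite [X in _ + X = _](_ : _ =
      - ((2 * (v + t))^-1 * \sum_(i < n) tnth z i ^+ 2)); last first.
    rewrite mulr_sumr sumrN; congr (- _); apply: eq_bigr => i _.
    by field; rewrite !gt_eqF ?addr_gt0.
  by field; rewrite !gt_eqF ?addr_gt0.
rewrite ge0_integral_mixture//.
rewrite /zweight -ge0_integralZl//; last first.
  move=> t /=; rewrite in_itv/= andbT => t0.
  by rewrite lee_fin mulr_ge0 ?profile_ge0// dens_ge0// ltW.
have E' (t : R) : t \in [set` `]0%R, +oo[] ->
   ((gamma t)%:E * \int[gauss (fun _ : 'I_n => 0%R) t]_mu
    (expR (- sqnorm (tnth z \- tnth mu) / (2 * v)))%:E =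
   (expR (n%:R * ln v / 2))%:E *
     (gamma t * profile n%:R (sqnorm (tnth z)) (v + t))%:E)%E.
  rewrite inE/= in_itv/= andbT => t0; rewrite E// -!EFinM; congr EFin.
  by rewrite mulrCA.
(* The endpoint [t = 0], where [gauss] takes a junk value, is a null set. *)
rewrite -integral_itv_obnd_cbnd; first exact: eq_integral.
move: (measurable_funeM (expR (n%:R * ln v / 2))%:E mg).
by apply: eq_measurable_fun => t /E' ->.
Qed.

(** The factor [v ^ (- n / 2)] splits: the share of [Y] completes its likelihood, and the share of
    [Z] cancels against the prefactor in [integral_mixture_expR]. *)
Lemma post_weightE alpha n gamma varpi (x : n.-tuple RT) v :
  (nnull alpha n <= n)%N -> 0 < v ->
  (post_weight alpha gamma varpi x v =
   (profile (nnull alpha n)%:R (sqnorm (tnth (Ypart alpha x))) v)%:E *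
   zweight gamma (n - nnull alpha n)%:R (sqnorm (tnth (Zpart alpha x))) v *
   (varpi v)%:E)%E.
Proof.
move=> nn v0; rewrite /post_weight integral_mixture_expR// muleA -EFinM.
congr (_%:E * _ * _)%E.
rewrite sqrtr_expR_ln// -expRM_natl -expRN -!expRD /profile; congr expR.
by rewrite natrB//; field; rewrite gt_eqF.
Qed.

End posterior.

(** * Deterministic bounds on the posterior *)

Section posterior_bounds.
Context {R : realType}.
Local Notation RT := (measurableTypeR R).
Implicit Types (gamma varpi : density R) (t v : R).

Lemma le_cst_integral_itv (f : R -> \bar R) (D : set R) (a b k : R) :
  a <= b -> 0 <= k -> `]a, b] `<=` D -> (forall x, D x -> (0 <= f x)%E) ->
  (forall x, a < x <= b -> (k%:E <= f x)%E) ->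
  ((k * (b - a))%:E <= \int[lebesgue_measure]_(x in D) f x)%E.
Proof.
move=> ab k0 abD f0 kf.
have -> : ((k * (b - a))%:E =
    \int[lebesgue_measure]_(x in (`]a, b] : set R)) (cst k%:E) x)%E.
  rewrite integral_cst//= lebesgue_measure_itv/= lte_fin EFinM; congr (_ * _)%E.
  case: ltP => // ba; have -> : a = b by apply/eqP; rewrite eq_le ab.
  by rewrite subrr.
exact: ge0_subset_le_integral.
Qed.

Lemma integral_dens_pos_le1 gamma :
  (\int[lebesgue_measure]_(t in `]0%R, +oo[) (gamma t)%:E <= 1)%E.
Proof.
rewrite -(integral_dens gamma); apply: ge0_subset_le_integral => //.
- by move=> t /=; rewrite !in_itv/= !andbT => /ltW.
- by move=> t /=; rewrite in_itv/= andbT => t0; rewrite lee_fin dens_ge0// ltW.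
- by move=> t /=; rewrite in_itv/= andbT => t0; rewrite lee_fin dens_ge0.
Qed.

Lemma integral_dens_posZl gamma (k : R) : 0 <= k ->
  (\int[lebesgue_measure]_(t in `]0%R, +oo[) (k%:E * (gamma t)%:E) <= k%:E)%E.
Proof.
move=> k0; rewrite ge0_integralZl//.
- by rewrite -[leRHS]mule1 lee_wpmul2l// ?integral_dens_pos_le1.
- by apply/measurable_EFinP; exact: measurable_dens_pos.
- by move=> t /=; rewrite in_itv/= andbT => t0; rewrite lee_fin dens_ge0// ltW.
Qed.

Lemma zweight_ge0 gamma (q s v : R) : (0 <= zweight gamma q s v)%E.
Proof.
apply: integral_ge0 => t /=; rewrite in_itv/= andbT => t0.
by rewrite lee_fin mulr_ge0 ?expR_ge0// dens_ge0// ltW.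
Qed.

(** Bound the profile by its maximum, taken at [D]; what remains is the mass of [gamma]. *)
Lemma zweight_le gamma (q D v : R) : 0 <= q -> 0 < D -> 0 < v ->
  (zweight gamma q (q * D) v <= (profile q (q * D) D)%:E)%E.
Proof.
move=> q0 D0 v0; apply: le_trans (integral_dens_posZl gamma (profile_ge0 _ _ _)).
apply: ge0_subset_le_integral => // t /=; rewrite in_itv/= andbT => t0.
- by rewrite lee_fin mulr_ge0 ?expR_ge0// dens_ge0// ltW.
- by rewrite mule_ge0// lee_fin ?expR_ge0 ?dens_ge0// ltW.
- rewrite -EFinM lee_fin mulrC ler_wpM2r ?dens_ge0 ?(ltW t0)//.
  by rewrite profile_le ?addr_gt0.
Qed.

(** Keep only those [t] with [v + t] between [D] and [D * (1 + e)]. They form an interval of length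
    [D * e], made of nonnegative [t] since [v <= D], and there [dev_le] bounds [dev ((v + t) / D)]
    by [e ^ 2]. *)
Lemma zweight_ge gamma (q D v e c : R) : 0 <= q -> 0 < D -> 0 <= e -> 0 < v <= D ->
  0 <= c -> (forall t, 0 <= t <= D * (1 + e) -> c <= gamma t) ->
  ((c * (profile q (q * D) D * expR (- (q / 2) * e ^+ 2)) * (D * e))%:E
     <= zweight gamma q (q * D) v)%E.
Proof.
move=> q0 D0 e0 /andP[v0 vD] c0 cg.
have -> : D * e = D * (1 + e) - v - (D - v) by ring.
apply: le_cst_integral_itv.
- by have := mulr_ge0 (ltW D0) e0; lra.
- by rewrite mulr_ge0// mulr_ge0 ?expR_ge0.
- by move=> t /=; rewrite !in_itv/= andbT => /andP[+ _]; lra.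
- move=> t /=; rewrite in_itv/= andbT => t0.
  by rewrite lee_fin mulr_ge0 ?expR_ge0// dens_ge0// ltW.
move=> t /andP[t1 t2]; rewrite lee_fin ler_pM//.
- by rewrite mulr_ge0 ?expR_ge0.
- by apply: cg; lra.
rewrite [leRHS]profileE//; last lra.
rewrite ler_wpM2l ?expR_ge0// ler_expR !mulNr lerN2 ler_wpM2l//; first lra.
have x1 : 1 <= (v + t) / D by rewrite ler_pdivlMr// mul1r; lra.
have x2 : (v + t) / D <= 1 + e by rewrite ler_pdivrMr// mulrC; lra.
apply: (le_trans (dev_le _)); first lra.
rewrite ler_pdivrMr; last lra.
move: x1 x2; set x := _ / D => x1 x2.
have h : (x - 1) ^+ 2 <= e ^+ 2 by rewrite ler_sqr ?nnegrE; lra.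
by apply: (le_trans h); rewrite ler_peMr ?sqr_ge0.
Qed.

(** If [b] is 0 or infinite, the quotient is 0. Hence [posterior_le1] holds for every data vector,
    whatever the normalizing constant. *)
Lemma ge0_lee_pdiv (a b : \bar R) : (0 <= a)%E -> (a <= b)%E -> (a / b <= 1)%E.
Proof.
move=> a0 ab; case: b ab => [b| |]; last 2 first.
- by rewrite invey mule0.
- by move=> /(le_trans a0).
case: a a0 => [a| |] //; rewrite !lee_fin => a0 ab.
have [b0|b0] := eqVneq b 0.
  have -> : a = 0 by apply/eqP; rewrite eq_le a0 -b0 ab.
  by rewrite mul0e lee01.
have b1 : 0 < b by rewrite lt_neqAle eq_sym b0 (le_trans a0).
by rewrite inver (negbTE b0) -EFinM lee_fin ler_pdivrMr// mul1r.
Qed.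

Lemma ge0_lee_div (a b : \bar R) (c d : R) : (0 <= a)%E -> (a <= c%:E)%E -> 0 < d ->
  (d%:E <= b)%E -> (a / b <= (c / d)%:E)%E.
Proof.
move=> a0 ac d0 db; case: a a0 ac => [a| |] //; rewrite !lee_fin => a0 ac.
have c0 := le_trans a0 ac.
case: b db => [b| |] //; last by rewrite invey mule0 lee_fin divr_ge0// ltW.
rewrite lee_fin => db; have b0 := lt_le_trans d0 db.
rewrite inver gt_eqF// -EFinM lee_fin ler_pM ?invr_ge0 ?(ltW b0)//.
by rewrite lef_pV2.
Qed.

Section data.
Variables (alpha : R) (n : nat) (gamma varpi : density R) (x : n.-tuple RT).

Lemma post_weight_ge0 v : 0 < v -> (0 <= post_weight alpha gamma varpi x v)%E.
Proof.
move=> v0; apply: mule_ge0; first apply: mule_ge0.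
- by rewrite lee_fin mulr_ge0 ?expR_ge0// invr_ge0 exprn_ge0 ?sqrtr_ge0.
- by apply: integral_ge0 => mu _; rewrite lee_fin expR_ge0.
- by rewrite lee_fin dens_ge0// ltW.
Qed.

Lemma posterior_ge0 (B : set R) : (0 <= posterior alpha gamma varpi x B)%E.
Proof.
apply: mule_ge0; last rewrite inve_ge0; apply: integral_ge0 => v.
- by move=> [_ /=]; rewrite in_itv/= andbT; exact: post_weight_ge0.
- by rewrite /= in_itv/= andbT; exact: post_weight_ge0.
Qed.

Lemma posterior_le1 (B : set R) : (posterior alpha gamma varpi x B <= 1)%E.
Proof.
apply: ge0_lee_pdiv.
  apply: integral_ge0 => v [_ /=].
  by rewrite in_itv/= andbT; exact: post_weight_ge0.
apply: ge0_subset_le_integral => // v.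
- by move=> [_ /=]; rewrite in_itv/= andbT; exact: post_weight_ge0.
- by rewrite /= in_itv/= andbT; exact: post_weight_ge0.
Qed.

Let p : R := (nnull alpha n)%:R.
Let q : R := (n - nnull alpha n)%:R.
Let SY := sqnorm (tnth (Ypart alpha x)).
Let SZ := sqnorm (tnth (Zpart alpha x)).

(** An upper bound on the weight far from [v0] is compared with a lower bound on an interval of
    length [v0 * e]. The maxima of both profiles cancel, the exponent collects the values of [dev],
    and [2 / (v0 ^ 2 * e ^ 2)] comes from the lengths [v0 * e] and [D * e], with [D >= v0 / 2]. *)
Lemma posterior_le (v0 e m cg cv : R) :
  (0 < nnull alpha n < n)%N -> 0 < v0 -> 0 < e <= 1 / 6 -> 0 <= m -> m * e <= 1 ->
  0 < cg -> 0 < cv ->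
  p * (v0 * (1 - e)) <= SY <= p * (v0 * (1 + e)) -> q * (v0 * (1 - e)) <= SZ ->
  (forall t, 0 <= t <= 2 * (SZ / q) -> cg <= gamma t) ->
  (forall v, v0 / 2 <= v <= v0 -> cv <= varpi v) ->
  (posterior alpha gamma varpi x [set v : R | (1 + 2 * m) * e <= `|v / v0 - 1|]%R <=
   (expR (- (p * m ^+ 2 / 32 - 9 * p - q / 2) * e ^+ 2) * 2 /
     (cg * cv * v0 ^+ 2 * e ^+ 2))%:E)%E.
Proof.
move=> /andP[p0 pn] v00 /andP[e0 e6] m0 me1 cg0 cv0 /andP[SY1 SY2] SZ1 hg hv.
have {}p0 : 0 < p by rewrite ltr0n.
have q0 : 0 < q by rewrite ltr0n subn_gt0.
(* [A] and [D] are the mean squares of [Y] and [Z], where the two profiles peak. *)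
have [A AE] : exists A, SY = p * A.
  by exists (SY / p); rewrite mulrCA divff ?mulr1// gt_eqF.
have [D DE] : exists D, SZ = q * D.
  by exists (SZ / q); rewrite mulrCA divff ?mulr1// gt_eqF.
rewrite AE !ler_pM2l// in SY1 SY2; rewrite DE ler_pM2l// in SZ1.
have ve0 : 0 < v0 * e by rewrite mulr_gt0.
have v0e : v0 * e <= v0 / 6 by rewrite ler_wpM2l ?(ltW v00)//; lra.
have A0 : 0 < A by lra.
have D0 : 0 < D by lra.
have DvE : SZ / q = D by rewrite DE mulrC mulKf// gt_eqF.
pose F := profile p (p * A) A; pose H := profile q (q * D) D.
have F0 : 0 < F by exact: expR_gt0.
have H0 : 0 < H by exact: expR_gt0.
(* This interval lies below both [A] and [D]. On it [v / A >= 1 - 3 * e >= 1 / 2], so that [dev (v /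
   A) <= (3 * e) ^ 2 / (v / A) <= 18 * e ^ 2]. *)
have lower v : v0 * (1 - 2 * e) < v <= v0 * (1 - e) ->
    ((F * expR (- (p / 2) * (18 * e ^+ 2)) *
      (cg * (H * expR (- (q / 2) * e ^+ 2)) * (D * e)) * cv)%:E <=
     post_weight alpha gamma varpi x v)%E.
  move=> /andP[v1 v2]; have vp : 0 < v by lra.
  rewrite post_weightE//; last exact: ltnW.
  rewrite -/p -/q -/SY -/SZ AE DE EFinM EFinM.
  apply: lee_pmul; rewrite ?mule_ge0 ?lee_fin ?(ltW cv0)//.
  - by rewrite mulr_ge0 ?expR_ge0// ltW.
  - by rewrite !mulr_ge0 ?expR_ge0 ?ltW.
  - apply: lee_pmul; rewrite ?lee_fin.
    + by rewrite mulr_ge0 ?expR_ge0// ltW.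
    + by rewrite !mulr_ge0 ?expR_ge0 ?ltW.
    + rewrite profileE// ler_wpM2l ?(ltW F0)// ler_expR !mulNr lerN2.
      rewrite ler_wpM2l//; first lra.
      have x1 : v / A <= 1 by rewrite ler_pdivrMr// mul1r; lra.
      have x2 : 1 - 3 * e <= v / A.
        rewrite ler_pdivlMr//.
        apply: (@le_trans _ _ ((1 - 3 * e) * (v0 * (1 + e)))).
          by rewrite ler_wpM2l//; lra.
        have : 0 <= v0 * e ^+ 2 by rewrite mulr_ge0 ?sqr_ge0// ltW.
        have -> : (1 - 3 * e) * (v0 * (1 + e)) = v0 * (1 - 2 * e) - 3 * (v0 * e ^+ 2).
          by ring.
        lra.
      apply: (le_trans (dev_le _)); first by rewrite divr_gt0.
      rewrite ler_pdivrMr ?divr_gt0//.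
      move: x1 x2; set y := v / A => x1 x2.
      apply: (@le_trans _ _ (9 * e ^+ 2)); first by nra.
      have := sqr_ge0 e; nra.
    + apply: zweight_ge => //; rewrite ?(ltW q0) ?(ltW e0) ?(ltW cg0) ?vp//; first lra.
      move=> t /andP[t0 t1]; apply: hg; rewrite DvE t0/=.
      apply: (le_trans t1); rewrite [leRHS]mulrC ler_wpM2l ?(ltW D0)//; lra.
  - by apply: hv; lra.
(* The window is centred at [v0], the likelihood of [Y] at [A]. Recentring costs
   [|v0 - A| <= v0 * e], and [A <= 2 * v0] turns the remaining [2 * m * e * v0] into a distance
   [m * e] of [v / A] from 1. *)
have upper v : (1 + 2 * m) * e <= `|v / v0 - 1| -> 0 < v ->
    (post_weight alpha gamma varpi x v <=
     (F * expR (- (p / 2) * ((m * e) ^+ 2 / 16)) * H)%:E * (varpi v)%:E)%E.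
  move=> vB vp; rewrite post_weightE//; last exact: ltnW.
  rewrite -/p -/q -/SY -/SZ AE DE; apply: lee_wpmul2r.
    by rewrite lee_fin dens_ge0// ltW.
  rewrite EFinM; apply: lee_pmul.
  - by rewrite lee_fin profile_ge0.
  - exact: zweight_ge0.
  - rewrite lee_fin profileE// ler_wpM2l ?(ltW F0)// ler_expR !mulNr lerN2.
    rewrite ler_wpM2l//; first lra.
    apply: dev_ge_sqr; rewrite ?divr_gt0 ?me1 ?mulr_ge0// ?(ltW e0)//.
    have vv : v0 * ((1 + 2 * m) * e) <= `|v - v0|.
      have -> : v - v0 = v0 * (v / v0 - 1) by field; rewrite gt_eqF.
      by rewrite normrM gtr0_norm// ler_pM2l.
    have Av : `|v0 - A| <= v0 * e by rewrite ler_norml; lra.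
    have -> : v / A - 1 = (v - A) / A by field; rewrite gt_eqF.
    rewrite normrM [`|A^-1|]gtr0_norm ?invr_gt0// ler_pdivlMr//.
    have -> : v - A = (v - v0) + (v0 - A) by ring.
    apply: le_trans (lerB_normD _ _).
    have : m * e * A <= m * e * (2 * v0).
      by rewrite ler_wpM2l ?mulr_ge0 ?(ltW e0)//; lra.
    lra.
  - by apply: zweight_le => //; rewrite ltW.
pose kd := F * expR (- (p / 2) * (18 * e ^+ 2)) *
  (cg * (H * expR (- (q / 2) * e ^+ 2)) * (D * e)) * cv.
have kd0 : 0 < kd by rewrite /kd !mulr_gt0 ?expR_gt0.
apply: (@le_trans _ _ ((F * expR (- (p / 2) * ((m * e) ^+ 2 / 16)) * H) /
    (kd * (v0 * (1 - e) - v0 * (1 - 2 * e))))%:E).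
  apply: ge0_lee_div.
  - apply: integral_ge0 => v [_ /=].
    by rewrite in_itv/= andbT; exact: post_weight_ge0.
  - apply: le_trans (integral_dens_posZl varpi _); last first.
      by rewrite !mulr_ge0 ?expR_ge0 ?(ltW F0) ?(ltW H0).
    apply: ge0_subset_le_integral => v.
    + by move=> [].
    + by move=> [_ /=]; rewrite in_itv/= andbT; exact: post_weight_ge0.
    + rewrite /= in_itv/= andbT => vp; rewrite mule_ge0// lee_fin.
        by rewrite !mulr_ge0 ?expR_ge0 ?(ltW F0) ?(ltW H0).
      by rewrite dens_ge0// ltW.
    + by move=> [vB /=]; rewrite in_itv/= andbT; exact: upper.
  - rewrite mulr_gt0//; lra.
  - apply: le_cst_integral_itv; first lra.
    + exact: ltW.
    + by move=> v /=; rewrite !in_itv/= andbT => /andP[+ _]; lra.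
    + by move=> v /=; rewrite in_itv/= andbT; exact: post_weight_ge0.
    + exact: lower.
rewrite lee_fin.
have -> : v0 * (1 - e) - v0 * (1 - 2 * e) = v0 * e by ring.
have -> : - (p * m ^+ 2 / 32 - 9 * p - q / 2) * e ^+ 2 =
  - (p / 2) * ((m * e) ^+ 2 / 16) - - (p / 2) * (18 * e ^+ 2) - - (q / 2) * e ^+ 2.
  by field.
rewrite !expRD ![expR (- (- _ * _))]expRN.
set E1 := expR _; set E2 := expR _; set E3 := expR _.
have E10 : 0 < E1 by exact: expR_gt0.
have E20 : 0 < E2 by exact: expR_gt0.
have E30 : 0 < E3 by exact: expR_gt0.
rewrite /kd -/E2 -/E3.
have -> : F * E1 * H / (F * E2 * (cg * (H * E3) * (D * e)) * cv * (v0 * e)) =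
    E1 / E2 / E3 / (cg * cv * v0 * e ^+ 2) * D^-1.
  by field; rewrite !gt_eqF.
have -> : E1 / E2 / E3 * 2 / (cg * cv * v0 ^+ 2 * e ^+ 2) =
    E1 / E2 / E3 / (cg * cv * v0 * e ^+ 2) * (v0 / 2)^-1.
  by field; rewrite !gt_eqF.
rewrite ler_wpM2l//.
  by rewrite !mulr_ge0// ?invr_ge0 ?mulr_ge0 ?exprn_ge0// ltW.
by rewrite lef_pV2 ?posrE; lra.
Qed.

End data.
End posterior_bounds.

(** * Chernoff bounds *)

Section deviations.
Context {R : realType}.
Local Notation RT := (measurableTypeR R).

Definition sqsum n (I : pred 'I_n) (x : n.-tuple RT) : R :=
  \sum_(i < n | I i) tnth x i ^+ 2.

Lemma measurable_sqsum n (I : pred 'I_n) (c k : R) :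
  measurable_fun [set: n.-tuple RT] (fun x => expR (k + c * sqsum I x)).
Proof.
apply: measurableT_comp => //; apply: measurable_funD => //.
apply: measurable_funM => //; rewrite /sqsum.
under eq_fun do rewrite big_mkcond; apply: measurable_sum => i.
case: (I i) => //; apply: measurable_funX; exact: measurable_tnth.
Qed.

(** This is the exponential moment of a noncentral chi-square sum, obtained with weights [c / v] on
    [I] and 0 elsewhere. Negative [c] serves the upper tails. *)
Lemma integral_gauss_sqsum n (m : 'I_n -> R) (I : pred 'I_n) (v c k : R) :
  0 < v -> 0 < 1 + 2 * c ->
  (\int[gauss m v]_x (expR (k + - (c / v) * sqsum I x))%:E =
   (expR (k + \sum_(i < n | I i)
      (- ln (1 + 2 * c) / 2 - c / v * m i ^+ 2 / (1 + 2 * c))))%:E)%E.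
Proof.
move=> v0 c0.
pose a i := if I i then c / v else 0.
have aE i : 1 + 2 * a i * v = if I i then 1 + 2 * c else 1.
  by rewrite /a; case: ifP => _; [field; rewrite gt_eqF|ring].
under eq_integral => x _.
  rewrite expRD EFinM (_ : - (c / v) * sqsum I x =
      - \sum_(i < n) a i * (0 - tnth x i) ^+ 2); last first.
    rewrite /sqsum mulNr mulr_sumr big_mkcond; congr (- _).
    apply: eq_bigr => i _; rewrite /a sub0r sqrrN.
    by case: ifP => _; rewrite ?mul0r.
  over.
rewrite ge0_integralZl//; last first.
  apply/measurable_EFinP; apply: measurableT_comp => //.
  apply: measurableT_comp => //; apply: measurable_sum => i.
  apply: measurable_funM => //; apply: measurable_funX; apply: measurable_funB => //.
  exact: measurable_tnth.
rewrite (@integral_gauss_expR _ _ _ (fun=> 0) a)//; last first.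
  by move=> i; rewrite aE; case: ifP.
rewrite -EFinM -expRD; congr (expR (_ + _))%:E.
rewrite [RHS]big_mkcond; apply: eq_bigr => i _.
rewrite aE /a; case: ifP => _; first by rewrite sub0r sqrrN.
by rewrite ln1 !(oppr0, mul0r, addr0).
Qed.

Lemma sum_le_card n (I : pred 'I_n) (F : 'I_n -> R) (c : R) :
  (forall i, I i -> F i <= c) -> \sum_(i < n | I i) F i <= #|I|%:R * c.
Proof. by move=> Fc; rewrite mulr_natl -sumr_const; exact: ler_sum. Qed.

(** Chernoff bound with tilt [e / 4]. The means only decrease the integral, so they are dropped;
    [dev_ge0] bounds the logarithm by [1 / (1 + e / 2)], which is expanded to second order. *)
Lemma lower_tail n (m : 'I_n -> R) (I : pred 'I_n) (v e : R) : 0 < v -> 0 < e ->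
  (\int[gauss m v]_x
    (expR (#|I|%:R * (e / 4 * (1 - e)) + - (e / 4 / v) * sqsum I x))%:E <=
   (expR (- (#|I|%:R * (e ^+ 2 / 8))))%:E)%E.
Proof.
move=> v0 e0; have c0 : 0 < 1 + 2 * (e / 4) by lra.
rewrite integral_gauss_sqsum// lee_fin ler_expR.
rewrite -lerBrDl -mulrN -mulrBr; apply: sum_le_card => i _.
have := dev_ge0 c0; rewrite /dev.
have : 0 <= e / 4 / v * m i ^+ 2 / (1 + 2 * (e / 4)).
  rewrite divr_ge0 ?(ltW c0)// mulr_ge0 ?sqr_ge0//.
  by rewrite divr_ge0 ?(ltW v0)// divr_ge0 ?(ltW e0).
have : (1 + 2 * (e / 4))^-1 <= 1 - e / 2 + e ^+ 2 / 4.
  have e3 : 0 <= e ^+ 3 by rewrite exprn_ge0// ltW.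
  rewrite -[leLHS]mul1r ler_pdivrMr//.
  have -> : (1 - e / 2 + e ^+ 2 / 4) * (1 + 2 * (e / 4)) = 1 + e ^+ 3 / 8 by field.
  lra.
lra.
Qed.

(** Chernoff bound with tilt [- e / 8], for centred coordinates since means would inflate the sum.
    The [e ^ 2 / 8] in the expansion of [1 / (1 - e / 4)] is twice the Taylor coefficient and
    absorbs the higher orders. *)
Lemma upper_tail0 n (m : 'I_n -> R) (I : pred 'I_n) (v e : R) : 0 < v -> 0 < e <= 1 ->
  (forall i, I i -> m i = 0) ->
  (\int[gauss m v]_x
    (expR (- (#|I|%:R * (e / 8 * (1 + e))) + - (- (e / 8) / v) * sqsum I x))%:E <=
   (expR (- (#|I|%:R * (e ^+ 2 / 16))))%:E)%E.
Proof.
move=> v0 /andP[e0 e1] mI; have c0 : 0 < 1 + 2 * - (e / 8) by lra.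
rewrite integral_gauss_sqsum// lee_fin ler_expR.
rewrite -lerBrDl.
have -> : - (#|I|%:R * (e ^+ 2 / 16)) - - (#|I|%:R * (e / 8 * (1 + e))) =
  #|I|%:R * (e / 8 * (1 + e) - e ^+ 2 / 16) by ring.
apply: sum_le_card => i Ii.
rewrite mI// expr0n/= mulr0 mul0r subr0.
have := dev_ge0 c0; rewrite /dev.
have : (1 + 2 * - (e / 8))^-1 <= 1 + e / 4 + e ^+ 2 / 8.
  have e3 : e ^+ 3 <= e ^+ 2 by rewrite exprS ler_piMl ?sqr_ge0.
  have e2 := sqr_ge0 e.
  rewrite -[leLHS]mul1r ler_pdivrMr//.
  have -> : (1 + e / 4 + e ^+ 2 / 8) * (1 + 2 * - (e / 8)) =
     1 + e ^+ 2 / 16 - e ^+ 3 / 32 by field.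
  lra.
lra.
Qed.

(** Only the order of magnitude of the sum matters here, to keep the mean square of [Z] bounded, so
    a fixed tilt suffices: the noise contributes at most [1 / 2] per coordinate and the mean at most
    [k / 2]. *)
Lemma upper_tail n (m : 'I_n -> R) (I : pred 'I_n) (v k : R) : 0 < v ->
  (forall i, I i -> m i ^+ 2 / v <= k) ->
  (\int[gauss m v]_x
    (expR (- (#|I|%:R * (3 / 2 + k / 2)) + - (- (1 / 4) / v) * sqsum I x))%:E <=
   (expR (- #|I|%:R))%:E)%E.
Proof.
move=> v0 mI; have c0 : 0 < 1 + 2 * - (1 / 4) :> R by lra.
rewrite integral_gauss_sqsum// lee_fin ler_expR.
rewrite -lerBrDl.
have -> : - #|I|%:R - - (#|I|%:R * (3 / 2 + k / 2)) = #|I|%:R * (1 / 2 + k / 2).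
  by field.
apply: sum_le_card => i Ii; have := mI i Ii.
have := dev_ge0 c0; rewrite /dev.
have -> : (1 + 2 * - (1 / 4))^-1 = 2 :> R by field.
have -> : - (1 / 4) / v * m i ^+ 2 * 2 = - (m i ^+ 2 / v) / 2 by field; rewrite gt_eqF.
lra.
Qed.

Lemma card_ord_lt n k : (k <= n)%N -> #|[pred i : 'I_n | (i < k)%N]| = k.
Proof.
move=> kn; rewrite -sum1_card (big_ord_narrow kn) sum1_card card_ord//.
Qed.

Lemma card_ord_ge n k : (k <= n)%N -> #|[pred i : 'I_n | (k <= i)%N]| = (n - k)%N.
Proof.
move=> kn; have := cardC [pred i : 'I_n | (i < k)%N].
rewrite card_ord_lt// card_ord => h.
rewrite -[in RHS]h addKn; apply: eq_card => i.
by rewrite !inE -leqNgt.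
Qed.

Lemma sqnorm_tuple n (x : n.-tuple RT) :
  sqnorm (tnth x) = \sum_(y <- x) (y : R) ^+ 2.
Proof. by rewrite [RHS]big_tuple. Qed.

Lemma sqnorm_Ypart (alpha : R) n (x : n.-tuple RT) : (nnull alpha n <= n)%N ->
  sqnorm (tnth (Ypart alpha x)) = sqsum [pred i : 'I_n | (i < nnull alpha n)%N] x.
Proof.
move=> kn; rewrite sqnorm_tuple /= (big_nth 0) size_takel ?size_tuple//.
rewrite (big_nat_widen _ _ _ _ _ kn)/= big_mkord.
by apply: eq_bigr => i ik; rewrite nth_take// (tnth_nth 0).
Qed.

Lemma sqnorm_Zpart (alpha : R) n (x : n.-tuple RT) : (nnull alpha n <= n)%N ->
  sqnorm (tnth (Zpart alpha x)) = sqsum [pred i : 'I_n | (nnull alpha n <= i)%N] x.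
Proof.
move=> kn; have : sqnorm (tnth x) =
    sqnorm (tnth (Ypart alpha x)) + sqnorm (tnth (Zpart alpha x)).
  by rewrite !sqnorm_tuple -big_cat/= cat_take_drop.
rewrite sqnorm_Ypart// /sqnorm (bigID [pred i : 'I_n | (i < nnull alpha n)%N])/=.
move=> /addrI <-; apply: eq_bigl => i; by rewrite -leqNgt.
Qed.

(** Indices start at 0, and [n * alpha < i + 1] exactly when the floor of [n * alpha] is at most
    [i]. *)
Lemma meanE (alpha : R) n (mu : (n - nnull alpha n).-tuple R) (i : 'I_n) :
  0 <= alpha ->
  mean alpha mu i = if (nnull alpha n <= i)%N then nth 0 mu (i - nnull alpha n) else 0.
Proof.
move=> a0; rewrite /mean; congr (if _ then _ else _).
have /andP[h1 h2] := truncn_itv (mulr_ge0 (ler0n R n) a0).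
rewrite -/(nnull alpha n) in h1 h2; apply/idP/idP => h.
  by rewrite -ltnS -(ltr_nat R) (le_lt_trans h1).
by rewrite (lt_le_trans h2)// ler_nat.
Qed.

End deviations.

(** * Expected posterior probability *)

Section risk.
Context {R : realType}.
Local Notation RT := (measurableTypeR R).

Lemma integral_add_le d (T : measurableType d) (mu : {measure set T -> \bar R})
    (f g : T -> R) (a b : R) :
  measurable_fun [set: T] f -> measurable_fun [set: T] g ->
  (forall x, 0 <= f x) -> (forall x, 0 <= g x) ->
  (\int[mu]_x (f x)%:E <= a%:E)%E -> (\int[mu]_x (g x)%:E <= b%:E)%E ->
  (\int[mu]_x (f x + g x)%:E <= (a + b)%:E)%E.
Proof.
move=> mf mg f0 g0 fa gb; under eq_integral do rewrite EFinD.
rewrite ge0_integralD//; first by rewrite EFinD leeD.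
- by move=> x _; rewrite lee_fin.
- exact/measurable_EFinP.
- by move=> x _; rewrite lee_fin.
- exact/measurable_EFinP.
Qed.

Section risk_bound.
Variables (alpha : R) (n : nat).
Let p : R := (nnull alpha n)%:R.
Let q : R := (n - nnull alpha n)%:R.

(** The first term bounds the posterior on data fit for [posterior_le]; the other four are the tails
    of [|Y|^2] (low, high) and [|Z|^2] (low, high). Only [a], [b] and [kappa] enter, not [v0] and
    [mu0], which makes the bound uniform. *)
Lemma risk_le (gamma varpi : density R) (a b kappa v0 e m cg cv : R)
    (mu0 : (n - nnull alpha n).-tuple R) :
  0 <= alpha -> (0 < nnull alpha n < n)%N -> 0 < a -> a <= v0 <= b ->
  (forall j, `|tnth mu0 j| <= kappa) ->
  0 < e <= 1 / 6 -> 0 <= m -> m * e <= 1 -> 0 < cg -> 0 < cv ->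
  (forall t, 0 <= t <= 8 * (b * (3 / 2 + kappa ^+ 2 / a / 2)) -> cg <= gamma t) ->
  (forall v, a / 2 <= v <= b -> cv <= varpi v) ->
  (\int[gauss (mean alpha mu0) v0]_x posterior alpha gamma varpi x
     [set v : R | (1 + 2 * m) * e <= `|v / v0 - 1|]%R <=
   (expR (- (p * m ^+ 2 / 32 - 9 * p - q / 2) * e ^+ 2) * 2 /
      (cg * cv * a ^+ 2 * e ^+ 2) +
    (expR (- (p * (e ^+ 2 / 8))) + (expR (- (p * (e ^+ 2 / 16))) +
    (expR (- (q * (e ^+ 2 / 8))) + expR (- q)))))%:E)%E.
Proof.
move=> al0 /[dup] npn /andP[p0 pn] a0 /andP[av vb] muk e06 m0 me1 cg0 cv0 hg hv.
have /andP[e0 e6] := e06.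
have v0p : 0 < v0 by exact: lt_le_trans av.
have pn' := ltnW pn.
set I := [pred i : 'I_n | (i < nnull alpha n)%N].
set J := [pred i : 'I_n | (nnull alpha n <= i)%N].
have cI : #|I|%:R = p by rewrite /I card_ord_lt.
have cJ : #|J|%:R = q by rewrite /J card_ord_ge.
set L := 3 / 2 + kappa ^+ 2 / a / 2.
have q0 : 0 < q by rewrite ltr0n subn_gt0.
(* Each Chernoff exponential exceeds 1, hence the posterior probability, as soon
   as the corresponding deviation inequality fails; this replaces a measurable
   event on which [posterior_le] applies. *)
pose U1 (x : n.-tuple RT) := expR (p * (e / 4 * (1 - e)) + - (e / 4 / v0) * sqsum I x).
pose U2 (x : n.-tuple RT) :=
  expR (- (p * (e / 8 * (1 + e))) + - (- (e / 8) / v0) * sqsum I x).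
pose U3 (x : n.-tuple RT) := expR (q * (e / 4 * (1 - e)) + - (e / 4 / v0) * sqsum J x).
pose U4 (x : n.-tuple RT) := expR (- (q * L) + - (- (1 / 4) / v0) * sqsum J x).
set rho := (X in (X + _)%:E).
have rho0 : 0 <= rho.
  by rewrite divr_ge0// ?mulr_ge0 ?expR_ge0 ?sqr_ge0 ?ltW.
have point x : (posterior alpha gamma varpi x
     [set v : R | (1 + 2 * m) * e <= `|v / v0 - 1|]%R <=
   (rho + (U1 x + (U2 x + (U3 x + U4 x))))%:E)%E.
  have U10 : 0 < U1 x by exact: expR_gt0.
  have U20 : 0 < U2 x by exact: expR_gt0.
  have U30 : 0 < U3 x by exact: expR_gt0.
  have U40 : 0 < U4 x by exact: expR_gt0.
  have big (u : R) : 1 <= u -> (posterior alpha gamma varpi x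
     [set v : R | (1 + 2 * m) * e <= `|v / v0 - 1|]%R <= u%:E)%E.
    by move=> u1; apply: (le_trans (posterior_le1 _ _ _ _ _)); rewrite lee_fin.
  have one_le (s : R) : 0 <= s -> 1 <= expR s by move=> s0; rewrite -expR0 ler_expR.
  have [h1|h1] := ltP (sqsum I x) (p * (v0 * (1 - e))).
    apply: big; have : 1 <= U1 x.
      apply: one_le.
      have -> : p * (e / 4 * (1 - e)) + - (e / 4 / v0) * sqsum I x =
        e / 4 / v0 * (p * (v0 * (1 - e)) - sqsum I x) by field; rewrite gt_eqF.
      by rewrite mulr_ge0 ?subr_ge0 ?(ltW h1)// divr_ge0 ?(ltW v0p)//; lra.
    lra.
  have [h2|h2] := ltP (p * (v0 * (1 + e))) (sqsum I x).
    apply: big; have : 1 <= U2 x.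
      apply: one_le.
      have -> : - (p * (e / 8 * (1 + e))) + - (- (e / 8) / v0) * sqsum I x =
        e / 8 / v0 * (sqsum I x - p * (v0 * (1 + e))) by field; rewrite gt_eqF.
      by rewrite mulr_ge0 ?subr_ge0 ?(ltW h2)// divr_ge0 ?(ltW v0p)//; lra.
    lra.
  have [h3|h3] := ltP (sqsum J x) (q * (v0 * (1 - e))).
    apply: big; have : 1 <= U3 x.
      apply: one_le.
      have -> : q * (e / 4 * (1 - e)) + - (e / 4 / v0) * sqsum J x =
        e / 4 / v0 * (q * (v0 * (1 - e)) - sqsum J x) by field; rewrite gt_eqF.
      by rewrite mulr_ge0 ?subr_ge0 ?(ltW h3)// divr_ge0 ?(ltW v0p)//; lra.
    lra.
  have [h4|h4] := ltP (q * (4 * v0 * L)) (sqsum J x).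
    apply: big; have : 1 <= U4 x.
      apply: one_le.
      have -> : - (q * L) + - (- (1 / 4) / v0) * sqsum J x =
        (4 * v0)^-1 * (sqsum J x - q * (4 * v0 * L)) by field; rewrite gt_eqF.
      by rewrite mulr_ge0 ?subr_ge0 ?(ltW h4)// invr_ge0 mulr_ge0 ?(ltW v0p).
    lra.
  have L0 : 0 <= L.
    by rewrite /L addr_ge0// divr_ge0// divr_ge0 ?sqr_ge0 ?(ltW a0).
  apply: (@le_trans _ _ (expR (- (p * m ^+ 2 / 32 - 9 * p - q / 2) * e ^+ 2) * 2 /
     (cg * cv * v0 ^+ 2 * e ^+ 2))%:E).
    apply: posterior_le => //.
    - by rewrite sqnorm_Ypart// h1 h2.
    - by rewrite sqnorm_Zpart.
    (* By [h4] the mean square of [Z] is at most [4 * v0 * L], and [posterior_le] needs [gamma] up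
       to twice that: hence the range [8 * (b * L)]. *)
    - move=> t /andP[t0 t1]; apply: hg; rewrite t0/= -/L; apply: (le_trans t1).
      rewrite sqnorm_Zpart//.
      have : sqsum J x / q <= 4 * v0 * L by rewrite ler_pdivrMr// mulrC.
      have : v0 * L <= b * L by rewrite ler_wpM2r.
      lra.
    - by move=> v /andP[v1 v2]; apply: hv; lra.
  rewrite lee_fin; apply: (@le_trans _ _ rho); last lra.
  rewrite /rho ler_wpM2l ?mulr_ge0 ?expR_ge0//.
  rewrite lef_pV2 ?posrE ?mulr_gt0 ?exprn_gt0//.
  by rewrite ler_pM2r ?exprn_gt0// ler_pM2l ?mulr_gt0// ler_sqr ?nnegrE// ltW.
apply: (@le_trans _ _ (\int[gauss (mean alpha mu0) v0]_x
    (rho + (U1 x + (U2 x + (U3 x + U4 x))))%:E)%E).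
  apply: ge0_subset_le_integral => //.
  - by move=> x _; exact: posterior_ge0.
  - by move=> x _; rewrite lee_fin !addr_ge0 ?expR_ge0.
have mU1 : measurable_fun [set: n.-tuple RT] U1 by exact: measurable_sqsum.
have mU2 : measurable_fun [set: n.-tuple RT] U2 by exact: measurable_sqsum.
have mU3 : measurable_fun [set: n.-tuple RT] U3 by exact: measurable_sqsum.
have mU4 : measurable_fun [set: n.-tuple RT] U4 by exact: measurable_sqsum.
have mU34 := measurable_funD mU3 mU4.
have mU24 := measurable_funD mU2 mU34.
have mU14 := measurable_funD mU1 mU24.
apply: integral_add_le => //; first by move=> x; rewrite !addr_ge0 ?expR_ge0.
  rewrite -[X in (_ <= X)%E]mule1 -(probability_setT (gauss (mean alpha mu0) v0)).
  by rewrite -integral_cst.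
apply: integral_add_le => //; first by move=> x; exact: expR_ge0.
- by move=> x; rewrite !addr_ge0 ?expR_ge0.
- by have := @lower_tail _ _ (mean alpha mu0) I _ _ v0p e0; rewrite cI.
apply: integral_add_le => //; first by move=> x; exact: expR_ge0.
- by move=> x; rewrite !addr_ge0 ?expR_ge0.
- have e01 : 0 < e <= 1 by lra.
  have mI i : I i -> mean alpha mu0 i = 0.
    by rewrite meanE// /I/= ltnNge => /negbTE ->.
  by have := @upper_tail0 _ _ (mean alpha mu0) I _ _ v0p e01 mI; rewrite cI.
apply: integral_add_le => //; first by move=> x; exact: expR_ge0.
- by move=> x; exact: expR_ge0.
- by have := @lower_tail _ _ (mean alpha mu0) J _ _ v0p e0; rewrite cJ.
suff mJ i : J i -> mean alpha mu0 i ^+ 2 / v0 <= kappa ^+ 2 / a.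
  by have := @upper_tail _ _ (mean alpha mu0) J _ _ v0p mJ; rewrite cJ.
rewrite /J/= => ip; rewrite meanE// ip.
have ij : (i - nnull alpha n < n - nnull alpha n)%N by rewrite ltn_sub2r.
rewrite -(tnth_nth 0 mu0 (Ordinal ij)) ler_pM ?sqr_ge0 ?invr_ge0 ?(ltW v0p)//.
- by rewrite -real_normK ?num_real// ler_sqr ?nnegrE// (le_trans _ (muk (Ordinal ij))).
- by rewrite lef_pV2.
Qed.

End risk_bound.
End risk.

(** * Asymptotics *)

Section asymptotics.
Context {R : realType}.

(** A positive continuous function attains a positive minimum on the compact interval [[0, L]]; for
    negative [L] the range of [t] is empty. *)
Lemma density_lower_bound (g : density R) : (forall x, 0 <= x -> 0 < g x) ->
  unif_continuous (g : subspace (`[0, +oo[ : set R) -> R) ->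
  forall L, exists2 c : R, 0 < c & forall t, 0 <= t <= L -> c <= g t.
Proof.
move=> g0 ug L; have [L0|L0] := leP 0 L; last by exists 1 => // t; lra.
have cg : {within (`[0, L] : set R), continuous g}.
  apply: (@continuous_subspaceW _ _ _ (`[0, +oo[ : set R)).
    by move=> t /=; rewrite !in_itv/= andbT => /andP[].
  move=> t; apply/cvg_entourageP => A /ug h.
  have := @nbhs_entourage (subspace (`[0, +oo[ : set R)) t _ h.
  by apply: filterS => y /xsectionP.
have [c + cmin] := EVT_min L0 cg.
rewrite in_itv/= => /andP[c0 _]; exists (g c); first exact: g0.
by move=> t tL; apply: cmin; rewrite in_itv.
Qed.

(** Inversion is continuous on [K], so its image is compact too; a bound on that image keeps [K]
    away from 0. *)
Lemma compact_gt0_bounds (K : set R) : compact K -> K `<=` [set x | 0 < x] ->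
  exists a b : R, 0 < a /\ forall v, K v -> a <= v <= b.
Proof.
move=> cK K0; have /compact_bounded[M [_ KM]] := cK.
have cV : {within K, continuous (@GRing.inv R)}.
  apply: continuous_in_subspaceT => x /set_mem /K0/= x0.
  by apply: inv_continuous; rewrite gt_eqF.
have /compact_bounded[N [_ KN]] := continuous_compact cV cK.
exists (`|N| + 1)^-1, (`|M| + 1); split; first by rewrite invr_gt0 ltr_wpDl.
move=> v Kv; have v0 : 0 < v by exact: K0.
apply/andP; split.
  rewrite -[leRHS]invrK lef_pV2 ?posrE ?invr_gt0 ?ltr_wpDl//.
  apply: (le_trans (ler_norm _)); apply: (KN (`|N| + 1)) => /=; last by exists v.
  by rewrite ltr_pwDr// ler_norm.
apply: (le_trans (ler_norm _)); apply: (KM (`|M| + 1)) => //=.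
by rewrite ltr_pwDr// ler_norm.
Qed.

Lemma ln_natr_ge (A : R) : \forall n \near \oo, A <= ln n%:R.
Proof.
near=> n; have h : expR A <= n%:R by near: n; exact: nbhs_infty_ger.
by rewrite -[A]expRK ler_ln ?posrE ?(lt_le_trans _ h) ?expR_gt0.
Unshelve. all: by end_near. Qed.

(** With [s = sqrt n], [ln n = 2 * ln s <= 2 * s], so [ln n / n <= 2 / s]. *)
Lemma sqrt_ln_div_le (d : R) : 0 < d ->
  \forall n \near \oo, Num.sqrt (ln n%:R / n%:R) <= d.
Proof.
move=> d0; near=> n.
have h : (2 / d ^+ 2) ^+ 2 <= n%:R by near: n; exact: nbhs_infty_ger.
have n0 : 0 < n%:R :> R.
  by apply: lt_le_trans h; rewrite exprn_gt0// divr_gt0// exprn_gt0.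
set s : R := Num.sqrt n%:R.
have s0 : 0 < s by rewrite sqrtr_gt0.
have ss : s ^+ 2 = n%:R by rewrite sqr_sqrtr// ltW.
have hs : 2 / d ^+ 2 <= s.
  by rewrite -ler_sqr ?nnegrE ?(ltW s0) ?ss// divr_ge0 ?exprn_ge0 ?ltW.
rewrite -[d]ger0_norm ?(ltW d0)// -sqrtr_sqr ler_wsqrtr//.
rewrite ler_pdivrMr// -ss lnXn// mulr2n.
have := ln_le_sub1 s0.
move: hs; rewrite ler_pdivrMr ?exprn_gt0// => hs.
have : s * 2 <= d ^+ 2 * s ^+ 2.
  by rewrite [leRHS](_ : _ = s * (s * d ^+ 2)); [rewrite ler_pM2l|ring].
lra.
Unshelve. all: by end_near. Qed.

Lemma cvg_expR_ln (C k : R) : 0 < k ->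
  (fun n : nat => (C * expR (- (k * ln n%:R)))%:E) @ \oo --> 0%E.
Proof.
move=> k0; apply: cvg_EFin; first by near=> n.
rewrite -[X in _ --> X](mulr0 C); apply: cvgMr.
apply: (@cvg_comp _ _ _ (fun n : nat => k * ln n%:R) (fun x : R => expR (- x))
  _ (pinfty_nbhs R)); last exact: cvgr_expR.
apply/cvgryPge => A; near=> n.
by rewrite -ler_pdivrMl//; near: n; exact: ln_natr_ge.
Unshelve. all: by end_near. Qed.

(* The condition on [m] makes the exponent of the first term at most
   [- 2 * ln n], which beats the factor [1 / e ^ 2 <= n]. *)
Lemma rate_le (alpha m n p q e c : R) : 0 < alpha < 1 -> 768 <= alpha * m ^+ 2 ->
  0 < c ->
  1 <= ln n -> 0 < n -> e ^+ 2 = ln n / n ->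
  n * alpha / 2 <= p <= n -> n * (1 - alpha) <= q <= n ->
  expR (- (p * m ^+ 2 / 32 - 9 * p - q / 2) * e ^+ 2) * 2 / (c * e ^+ 2) +
    (expR (- (p * (e ^+ 2 / 8))) + (expR (- (p * (e ^+ 2 / 16))) +
    (expR (- (q * (e ^+ 2 / 8))) + expR (- q)))) <=
  (2 / c + 4) * expR (- (alpha * (1 - alpha) / 32 * ln n)).
Proof.
move=> /andP[al0 al1] hm c0 ln1 n0 eE /andP[p1 p2] /andP[q1 q2].
have l0 : 0 < ln n by lra.
have e20 : 0 < e ^+ 2 by rewrite eE divr_gt0.
have ne : n * e ^+ 2 = ln n by rewrite eE mulrCA divff ?mulr1// gt_eqF.
have aa : 0 < alpha * (1 - alpha) by rewrite mulr_gt0//; lra.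
have aa1 : alpha * (1 - alpha) <= alpha by rewrite ler_piMr ?(ltW al0)//; lra.
have aa2 : alpha * (1 - alpha) <= 1 - alpha by rewrite ler_piMl//; lra.
(* The smallest exponent is [p * e ^ 2 / 16 >= alpha * ln n / 32]; the product with [1 - alpha]
   covers the terms in [q] as well. *)
set k := alpha * (1 - alpha) / 32.
have pe : ln n * alpha / 2 <= p * e ^+ 2.
  rewrite -ne (_ : _ * alpha / 2 = n * alpha / 2 * e ^+ 2); last by ring.
  by rewrite ler_pM2r.
have qe : ln n * (1 - alpha) <= q * e ^+ 2.
  rewrite -ne (_ : _ * (1 - alpha) = n * (1 - alpha) * e ^+ 2); last by ring.
  by rewrite ler_pM2r.
have lk (x : R) : 32 * k <= x -> ln n * (32 * k) <= ln n * x.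
  by move=> kx; rewrite ler_pM2l.
have la := lk alpha ltac:(rewrite /k; lra).
have lb := lk (1 - alpha) ltac:(rewrite /k; lra).
have k0 : 0 < k by rewrite divr_gt0.
have k1 : k <= 1 by rewrite /k; lra.
clearbody k.
have lk0 : 0 < ln n * k by rewrite mulr_gt0.
have E1 : expR (- (p * (e ^+ 2 / 8))) <= expR (- (k * ln n)) by rewrite ler_expR; lra.
have E2 : expR (- (p * (e ^+ 2 / 16))) <= expR (- (k * ln n)) by rewrite ler_expR; lra.
have E3 : expR (- (q * (e ^+ 2 / 8))) <= expR (- (k * ln n)) by rewrite ler_expR; lra.
have E4 : expR (- q) <= expR (- (k * ln n)).
  rewrite ler_expR; have lnn := ln_le_sub1 n0.
  have : ln n * (1 - alpha) <= n * (1 - alpha) by rewrite ler_pM2r; lra.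
  lra.
have E0 : expR (- (p * m ^+ 2 / 32 - 9 * p - q / 2) * e ^+ 2) * 2 /
    (c * e ^+ 2) <= 2 / c * expR (- (k * ln n)).
  have -> : expR (- (p * m ^+ 2 / 32 - 9 * p - q / 2) * e ^+ 2) * 2 /
    (c * e ^+ 2) = 2 / c *
      (expR (- (p * m ^+ 2 / 32 - 9 * p - q / 2) * e ^+ 2) / e ^+ 2).
    by rewrite invfM; ring.
  rewrite ler_pM2l ?divr_gt0//.
  have ei : (e ^+ 2)^-1 <= expR (ln n).
    by rewrite lnK ?posrE// eE invf_div ler_pdivrMr// ler_peMr// ltW.
  (* From [p >= n * alpha / 2] follows [p * m ^ 2 / 32 >= 768 * n / 64 = 12 * n], while
     [9 * p + q / 2 <= 9.5 * n]; more than [2 * n] is left, and [n * e ^ 2 = ln n]. *)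
  apply: (@le_trans _ _ (expR (- (2 * ln n)) * expR (ln n))).
    rewrite ler_pM ?expR_ge0 ?invr_ge0 ?(ltW e20)// ler_expR mulNr lerN2 -ne mulrA.
    rewrite ler_pM2r//.
    have : n * alpha / 2 * m ^+ 2 <= p * m ^+ 2 by rewrite ler_wpM2r ?sqr_ge0.
    have : n * 768 <= n * (alpha * m ^+ 2) by rewrite ler_pM2l.
    lra.
  rewrite -expRD ler_expR.
  have : ln n * k <= ln n * 1 by rewrite ler_pM2l.
  lra.
lra.
Qed.

Lemma nnull_bounds (alpha : R) : 0 < alpha < 1 -> \forall n \near \oo,
  (0 < nnull alpha n < n)%N /\
  n%:R * alpha / 2 <= (nnull alpha n)%:R :> R.
Proof.
move=> /andP[al0 al1]; near=> n.
have h : 2 / alpha <= n%:R by near: n; exact: nbhs_infty_ger.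
rewrite ler_pdivrMr// in h.
have n0 : 0 < n%:R :> R by rewrite -(pmulr_lgt0 _ al0); lra.
have na0 : 0 <= n%:R * alpha by rewrite mulr_ge0 ?ltW.
have /andP[h1 h2] := truncn_itv na0.
rewrite -/(nnull alpha n) -natr1 in h1 h2.
split; last lra.
rewrite -(ltr_nat R) -[(_ < n)%N](ltr_nat R); apply/andP; split; first lra.
by apply: (le_lt_trans h1); rewrite gtr_pMr.
Unshelve. all: by end_near. Qed.

End asymptotics.

Unset Implicit Arguments.
Set Strict Implicit.

Theorem corollary5p3 (R : realType) (alpha : R) (alpha01 : 0 < alpha < 1) :
  exists M : R, forall (gamma varpi : density R),
    (forall x, 0 <= x -> 0 < gamma x) ->
    (forall x, 0 <= x -> 0 < varpi x) ->
    unif_continuous (gamma : subspace (`[0, +oo[ : set R) -> R) ->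
    unif_continuous (varpi : subspace (`[0, +oo[ : set R) -> R) ->
    forall K K' : set R,
      compact K -> K `<=` [set x | 0 < x] -> compact K' ->
      (fun n : nat => ereal_sup ([set 0%E] `|` [set e |
         exists (v0 : R) (mu0 : (n - nnull alpha n).-tuple R),
         [/\ K v0, forall j, K' (tnth mu0 j) &
          e = (\int[gauss (mean alpha mu0) v0]_x
                posterior alpha gamma varpi x
                  [set v : R | M * Num.sqrt (ln n%:R / n%:R) <= `|v / v0 - 1|]%R)%E]]))
      @ \oo --> 0%E.
Proof.
have /andP[al0 al1] := alpha01.
(* As [28 ^ 2 = 784] and [alpha < 1], this meets the condition [768 <= alpha * m ^ 2] of [rate_le],
   and it depends on [alpha] alone. *)
pose m := 28 / alpha.
have m0 : 0 < m by rewrite divr_gt0.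
have hm : 768 <= alpha * m ^+ 2.
  have -> : alpha * m ^+ 2 = 784 / alpha by rewrite /m; field; rewrite gt_eqF.
  by rewrite ler_pdivlMr//; lra.
exists (1 + 2 * m) => gamma varpi g0 v0 ug uv K K' cK K0 cK'.
have [a [b [a0 ab]]] := compact_gt0_bounds cK K0.
have /compact_bounded[N [_ KN]] := cK'.
pose kappa := `|N| + 1.
have [cg cg0 hg] := density_lower_bound g0 ug (8 * (b * (3 / 2 + kappa ^+ 2 / a / 2))).
have [cv cv0 hv] := density_lower_bound v0 uv b.
have c0 : 0 < cg * cv * a ^+ 2 by rewrite !mulr_gt0 ?exprn_gt0.
have k0 : 0 < alpha * (1 - alpha) / 32 by rewrite divr_gt0// mulr_gt0//; lra.
apply: squeeze_cvge (cvg_cst _)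
  (cvg_expR_ln (2 / (cg * cv * a ^+ 2) + 4) k0).
near=> n; apply/andP; split.
  (* The adjoined element 0 keeps the supremum nonnegative, even over an empty parameter set. *)
  by apply: ereal_sup_ubound; left.
apply: ge_ereal_sup => u [->|[w [mu [Kw K'mu ->]]]].
  by rewrite lee_fin mulr_ge0 ?expR_ge0// addr_ge0// divr_ge0// ltW.
have [npn pn2] : (0 < nnull alpha n < n)%N /\
  n%:R * alpha / 2 <= (nnull alpha n)%:R :> R.
  by near: n; exact: nnull_bounds.
have /andP[p0 pn] := npn.
have n0 : 0 < n%:R :> R by rewrite ltr0n (leq_trans _ pn).
have ln1 : 1 <= ln n%:R :> R by near: n; exact: ln_natr_ge.
set e := Num.sqrt _.
have ln0 : 0 < ln n%:R / n%:R :> R by rewrite divr_gt0//; lra.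
have e0 : 0 < e by rewrite sqrtr_gt0.
have e6 : e <= 1 / 6 by rewrite /e; near: n; apply: sqrt_ln_div_le; lra.
have em : e <= m^-1 by rewrite /e; near: n; apply: sqrt_ln_div_le; rewrite invr_gt0.
have eE : e ^+ 2 = ln n%:R / n%:R by rewrite sqr_sqrtr// ltW.
have e06 : 0 < e <= 1 / 6 by rewrite e0.
have muk j : `|tnth mu j| <= kappa.
  by apply: (KN kappa) => //; rewrite /kappa ltr_pwDr// ler_norm.
have me1 : m * e <= 1 by rewrite mulrC -ler_pdivlMr// mul1r.
have hv' v : a / 2 <= v <= b -> cv <= varpi v.
  by move=> /andP[v1 v2]; apply: hv; lra.
apply: (le_trans (risk_le (ltW al0) npn a0 (ab w Kw) muk e06 (ltW m0) me1
  cg0 cv0 hg hv')).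
rewrite lee_fin; apply: rate_le => //.
- by rewrite pn2/= ler_nat ltnW.
have /andP[h1 _] := truncn_itv (mulr_ge0 (ltW n0) (ltW al0)).
rewrite -/(nnull alpha n) in h1.
rewrite natrB ?(ltnW pn)//; apply/andP; split; last first.
  by rewrite lerBlDr lerDl.
lra.
Unshelve. all: by end_near. Qed.
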